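(* Let $A\in\mathbb{R}^{n\times n}$, and let $C_{ij}\in\mathbb{R}^{m_{ij}\times n}$ ($i,j\in\{1,\dots,q\}$) be matrices with $C_{ii}=0$. Assume: (1) $C_{ij}=C_{ji}$ for all $i,j$; (2) the graph $\mathcal{G}$ associated to $\{C_{ij}\}$ is connected; (3) $A$ is neutrally stable (in the discrete-time sense); (4) the pair $(C_{ij},A)$ is detectable (in the discrete-time sense) for all $i,j$ with $C_{ij}\neq0$. Let $n_1\le n$ be the number of eigenvalues of $A$ on the unit circle and $n_2:=n-n_1$. Define gains $G_{ij}\in\mathbb{R}^{n\times m_{ij}}$ as follows. If $n_1=0$, let $G_{ij}:=0$. Otherwise, choose any $U\in\mathbb{R}^{n\times n_1}$ and $W\in\mathbb{R}^{n\times n_2}$ such that $[U\ \ W]$ is invertible and $$[U\ \ W]^{-1}A[U\ \ W]=\begin{bmatrix}Q&0\\0&F\end{bmatrix}$$ where $Q\in\mathbb{R}^{n_1\times n_1}$ is orthogonal and $F\in\mathbb{R}^{n_2\times n_2}$ is stable (in the discrete-time sense), and let $G_{ij}:=UQU^{T}C_{ij}^{T}$. Let $L$ be the matrix-weighted Laplacian with weights $Q_{ij}:=U^{T}C_{ij}^{T}C_{ij}U$ and let $\bar\varepsilon>0$ satisfy $L\ge\bar\varepsilon L^{2}$. (If $n_1=0$, then $U$ and $L$ are void and the condition on $\bar\varepsilon$ is vacuous.) Then for all $\varepsilon\in(0,\bar\varepsilon]$ the coupled systems $$x_i(k+1)=Ax_i(k)+\varepsilon\sum_{j=1}^{q}G_{ij}C_{ij}(x_j(k)-x_i(k)),\qquad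 i=1,\dots,q,\quad x_i(k)\in\mathbb{R}^n,\ k\in\mathbb{N},$$ synchronize. Moreover, the solutions $x_i(k)$ remain bounded.
   Context: The graph $\mathcal{G}$ associated to a set of matrices $\{C_{ij}\}$ has vertices $v_1,\dots,v_q$, and $(v_j,v_i)$ is an edge exactly when $C_{ij}\neq 0$; since $C_{ij}=C_{ji}$, the graph is undirected. Discrete-time definitions: $A$ is neutrally stable if it has no eigenvalue of magnitude larger than one and, for each eigenvalue on the unit circle, the corresponding Jordan blocks are one-by-one. A matrix is stable if all its eigenvalues lie in the open unit disk. $(C,A)$ is detectable if no eigenvector of $A$ with eigenvalue on or outside the unit circle belongs to the null space of $C$. Eigenvalues are counted with multiplicity. The matrix-weighted Laplacian with symmetric positive semidefinite weights $Q_{ij}$ ($Q_{ii}=0$) of size $n_1\times n_1$ is the $qn_1\times qn_1$ block matrix $L$ whose $(i,i)$ block is $\sum_{j}Q_{ij}$ and whose $(i,j)$ block is $-Q_{ij}$ for $i\ne j$. For symmetric matrices, $X\ge Y$ means $X-Y$ is positive semidefinite. The systems are said to synchronize if $\|x_i(k)-x_j(k)\|\to0$ as $k\to\infty$ for all indices $i,j$ and all initial conditions. *)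

(* Defs.v *)
From mathcomp Require Import all_boot all_order all_algebra.
From mathcomp Require Import complex.
From mathcomp Require Import all_classical all_reals all_analysis.

Set Implicit Arguments.
Unset Strict Implicit.
Unset Printing Implicit Defensive.

Import Order.TTheory GRing.Theory Num.Theory.
Import numFieldNormedType.Exports.

Local Open Scope ring_scope.
Local Open Scope classical_set_scope.

Definition complexify (R : rcfType) (m n : nat) (A : 'M[R]_(m, n)) :
    'M[R[i]]_(m, n) :=
  map_mx (real_complex R) A.

(* The spectrum of A in R[i], each eigenvalue being repeated according to its
   algebraic multiplicity: a sequence r with
   char_poly A = \prod_(z <- r) ('X - z%:P). *)
Definition eigenvalue_seq (R : rcfType) (n : nat) (A : 'M[R]_n) : seq R[i] :=
  sval (closed_field_poly_normal (char_poly (complexify A))).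

Definition nb_unit_eigenvalues (R : rcfType) (n : nat) (A : 'M[R]_n) : nat :=
  count (fun z => `|z| == 1) (eigenvalue_seq A).

Definition stable (R : rcfType) (n : nat) (A : 'M[R]_n) : Prop :=
  forall z : R[i], eigenvalue (complexify A) z -> `|z| < 1.

Definition jordan_block (K : fieldType) (p : nat) (a : K) : 'M[K]_p :=
  \matrix_(i, j) (a *+ (i == j) + (i.+1 == j :> nat)%:R).

(* A is similar to the block-diagonal matrix whose diagonal blocks are the
   Jordan blocks of size p i and eigenvalue a i. *)
Definition jordan_form (K : fieldType) (n : nat) (A : 'M[K]_n)
    (k : nat) (p : 'I_k -> nat) (a : 'I_k -> K) : Prop :=
  (forall i, (0 < p i)%N) /\
  exists (e : (\sum_(i < k) p i)%N = n) (P : 'M[K]_n),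
    P \in unitmx /\
    invmx P *m A *m P =
      castmx (e, e) (\mxdiag_(i < k) jordan_block (p i) (a i)).

Definition neutrally_stable (R : rcfType) (n : nat) (A : 'M[R]_n) : Prop :=
  (forall z : R[i], eigenvalue (complexify A) z -> `|z| <= 1) /\
  exists (k : nat) (p : 'I_k -> nat) (a : 'I_k -> R[i]),
    jordan_form (complexify A) p a /\
    forall i, `|a i| = 1 -> p i = 1%N.

(* Eigenvectors are column vectors here, whereas [eigenvalue] and [eigenspace]
   refer to row vectors. *)
Definition detectable (R : rcfType) (m n : nat)
    (C : 'M[R]_(m, n)) (A : 'M[R]_n) : Prop :=
  forall (z : R[i]) (v : 'cV[R[i]]_n), v != 0 ->
    complexify A *m v = z *: v -> 1 <= `|z| -> complexify C *m v != 0.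

Definition orthogonal_mx (R : rcfType) (n : nat) (Q : 'M[R]_n) : Prop :=
  Q^T *m Q = 1%:M.

Definition psd (R : rcfType) (n : nat) (X : 'M[R]_n) : Prop :=
  X^T = X /\ forall v : 'cV[R]_n, 0 <= (v^T *m X *m v) 0 0.

Definition coupling_graph (R : rcfType) (q n : nat) (m : 'I_q -> 'I_q -> nat)
    (C : forall i j, 'M[R]_(m i j, n)) : rel 'I_q :=
  fun j i => C i j != 0.

Definition connected_graph (T : finType) (e : rel T) : Prop :=
  forall v w : T, connect e v w.

Definition laplacian (R : rcfType) (q n1 : nat)
    (Q : 'I_q -> 'I_q -> 'M[R]_n1) : 'M[R]_(\sum_(i < q) n1) :=
  \mxblock_(i < q, j < q) (if i == j then \sum_(l < q) Q i l else - Q i j).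

Definition is_solution (R : rcfType) (q n : nat) (m : 'I_q -> 'I_q -> nat)
    (A : 'M[R]_n) (C : forall i j, 'M[R]_(m i j, n))
    (G : forall i j, 'M[R]_(n, m i j)) (eps : R)
    (x : nat -> 'I_q -> 'cV[R]_n) : Prop :=
  forall (k : nat) (i : 'I_q),
    x k.+1 i =
      A *m x k i + eps *: \sum_(j < q) G i j *m C i j *m (x k j - x k i).

(* The norm `|v| which the library puts on matrices is the max norm. *)
Definition euclidean_norm (R : rcfType) (n : nat) (v : 'cV[R]_n) : R :=
  Num.sqrt (\sum_(i < n) v i 0 ^+ 2).

Definition synchronize (R : realType) (q n : nat) (m : 'I_q -> 'I_q -> nat)
    (A : 'M[R]_n) (C : forall i j, 'M[R]_(m i j, n))
    (G : forall i j, 'M[R]_(n, m i j)) (eps : R) : Prop :=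
  forall x : nat -> 'I_q -> 'cV[R]_n, is_solution A C G eps x ->
    forall i j : 'I_q,
      (fun k : nat => euclidean_norm (x k i - x k j)) @ \oo --> (0 : R).

Definition bounded_trajectories (R : rcfType) (q n : nat)
    (x : nat -> 'I_q -> 'cV[R]_n) : Prop :=
  exists M : R, forall (k : nat) (i : 'I_q), euclidean_norm (x k i) <= M.

(* Main.v *)
Require Import Defs.
From mathcomp Require Import all_boot all_order all_algebra.
From mathcomp Require Import complex.
From mathcomp Require Import all_classical all_reals all_analysis.
From mathcomp Require Import ring lra.

(** Everything is linear and time-invariant, so synchronization is a statement
    about eigenvalues.

    Write K_ij = G_ij C_ij.  Since C_ij = C_ji, these gains are symmetric, the
    coupling terms cancel in the sum over all systems, and the mean of the x_i
    obeys the uncoupled recursion x(k+1) = A x(k) [mean_solution].  The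
    deviations d_i = x_i - mean sum to zero and evolve under the matrix T
    [disagreement_mx] that applies the coupled dynamics and then subtracts its
    mean.  It suffices to show that T is stable [disagreement_stable]: then
    the deviations vanish [deviation_cvg0, by stable_cvg0], hence the systems
    synchronize, and boundedness reduces to that of the mean, on which A acts
    as the orthogonal Q and the stable F in suitable coordinates.

    Suppose T d = lambda d with |lambda| >= 1.  The range of T consists of
    stacks with zero sum, so d has zero sum and T d is the coupled dynamics
    applied to d.  The coupling enters only through the range of U, so the F
    components of d are eigenvectors of F for lambda, and vanish.  On the Q
    components xi, the dynamics is (I (x) Q)(I - eps L).  As
    L >= epsbar L^2 >= eps L^2,
      |xi - eps L xi|^2 = |xi|^2 - 2 eps <xi, L xi> + eps^2 |L xi|^2
                       <= |xi|^2 - eps <xi, L xi>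
    [gradient_step_sqnorm], whereas the left-hand side is
    |lambda|^2 |xi|^2 >= |xi|^2; so <xi, L xi> = 0
    [unstable_mode_energy0].  This energy is half the sum of the
    |C_ij U (xi_i - xi_j)|^2 [energy_laplacian_gram], so C_ij (d_i - d_j) = 0
    for all i, j [laplacian_unstable_mode].  The coupling therefore vanishes
    along d, each d_i - d_j is zero or an eigenvector of A for lambda, and
    detectability gives d_i = d_j on every edge.  By connectedness all the d_i
    are equal, and as they sum to zero, d = 0.

    If A has no eigenvalue on the unit circle, neutral stability makes A
    stable, the gains vanish, and each x_i tends to 0. *)

Set Implicit Arguments.
Unset Strict Implicit.
Unset Printing Implicit Defensive.

Import Order.TTheory GRing.Theory Num.Theory.
Import numFieldNormedType.Exports.

Local Open Scope ring_scope.

(** * Powers of stable matrices *)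

(** Past a large index the input u stays below a small multiple of 1 - r, and
    the distance of a to the corresponding fixed point decays like r ^+ k. *)
Lemma cvg0_contractive (R : realType) (r : R) (a u : nat -> R) :
  0 <= r < 1 -> (forall k, 0 <= a k) ->
  (forall k, a k.+1 <= r * a k + u k) ->
  (u @ \oo --> (0 : R))%classic -> (a @ \oo --> (0 : R))%classic.
Proof.
move=> /andP[r0 r1] a0 aS u0; apply/cvgr0Pnorm_lt => e e0.
have r1' : 0 < 1 - r by rewrite subr_gt0.
have d0 : 0 < e / 2 * (1 - r) by rewrite mulr_gt0 // divr_gt0.
have /cvgr0Pnorm_lt/(_ _ d0)[N _ uN] := u0.
(* e / 2 is the fixed point of the recursion driven by e / 2 * (1 - r). *)
have aN j : a (j + N)%N <= r ^+ j * a N + e / 2.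
  elim: j => [|j IH]; first by rewrite add0n expr0 mul1r lerDl; lra.
  rewrite addSn; apply: le_trans (aS _) _.
  have : u (j + N)%N < e / 2 * (1 - r).
    by apply: le_lt_trans (ler_norm _) (uN _ _); rewrite /= leq_addl.
  have := ler_wpM2l r0 IH; rewrite exprS; lra.
have rj : (geometric (a N) r @ \oo --> (0 : R))%classic.
  by apply: cvg_geometric; rewrite ger0_norm.
have e20 : 0 < e / 2 by rewrite divr_gt0.
have /cvgr0Pnorm_lt/(_ _ e20)[J _ rJ] := rj.
exists (J + N)%N => // k /= JNk; rewrite ger0_norm //.
have Nk : (N <= k)%N by apply: leq_trans JNk; rewrite leq_addl.
rewrite -(subnK Nk); apply: le_lt_trans (aN _) _.
have /rJ/(le_lt_trans (ler_norm _)) : (J <= k - N)%N by rewrite leq_subRL // addnC.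
rewrite /geometric /=; lra.
Qed.

Notation normc := ComplexField.Normc.normc.

Lemma normc_ge0 (R : rcfType) (z : R[i]) : 0 <= normc z.
Proof. by case: z => a b; rewrite sqrtr_ge0. Qed.

Lemma normc_real (R : rcfType) (a : R) : normc (real_complex R a) = `|a|.
Proof. by rewrite /= expr0n addr0 sqrtr_sqr. Qed.

Lemma normr_normc (R : rcfType) (z : R[i]) : `|z| = real_complex R (normc z).
Proof. by case: z => a b; rewrite normc_def. Qed.

Lemma ltr_normc1 (R : rcfType) (z : R[i]) : (`|z| < 1) = (normc z < 1).
Proof. by rewrite normr_normc ltcR. Qed.

Lemma ler_normc1 (R : rcfType) (z : R[i]) : (1 <= `|z|) = (1 <= normc z).
Proof. by rewrite normr_normc lecR. Qed.

(** A polynomial p acts on the sequence M ^+ k v by the operator p(M), under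
    which 'X is the shift.  Removing a factor 'X - z from an operator whose
    output tends to 0 means solving a scalar recursion with ratio z, which
    preserves the limit 0 as |z| < 1.  The entry i is fixed throughout, so no
    norm on vectors is needed. *)
Lemma horner_mx_factors_cvg0 (R : realType) (n : nat) (M : 'M[R[i]]_n.+1)
    (v : 'cV[R[i]]_n.+1) (i : 'I_n.+1) (r : seq R[i]) (p : {poly R[i]}) :
  all (fun z => normc z < 1) r ->
  ((fun k => normc ((horner_mx M ((\prod_(z <- r) ('X - z%:P)) * p * 'X^k)
                     *m v) i 0)) @ \oo --> (0 : R))%classic ->
  ((fun k => normc ((horner_mx M (p * 'X^k) *m v) i 0)) @ \oo
     --> (0 : R))%classic.
Proof.
elim: r p => [|z r IH] p; first by rewrite big_nil mul1r.
move=> /= /andP[z1 r1] h; apply: IH => //.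
move: h; rewrite big_cons; set P := \prod_(_ <- _) _ => h.
apply: (cvg0_contractive (r := normc z)) h; first by rewrite z1 andbT normc_ge0.
  by move=> k; apply: normc_ge0.
move=> k; rewrite -ComplexField.Normc.normcM.
have -> : P * p * 'X^(k.+1) =
    z%:P * (P * p * 'X^k) + ('X - z%:P) * P * p * 'X^k.
  by rewrite exprS -!mulrA mulrBl addrC subrK !(mulrCA 'X).
rewrite rmorphD mulmxDl mxE /= rmorphM /= horner_mx_C.
by rewrite -mulmxE -mulmxA mul_scalar_mx mxE; apply: le_normcD.
Qed.

(** By Cayley-Hamilton the characteristic polynomial of M, a product of
    factors 'X - z with |z| < 1, maps the trajectory to 0; removing these
    factors one by one leaves the trajectory itself.  This route needs neither
    a Jordan form nor a norm adapted to M. *)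
Lemma stable_cvg0 (R : realType) (n : nat) (M : 'M[R]_n)
    (w : nat -> 'cV[R]_n) (i : 'I_n) :
  stable M -> (forall k, w k.+1 = M *m w k) ->
  ((fun k => w k i 0) @ \oo --> (0 : R))%classic.
Proof.
case: n M w i => [|n] M w i; first by case: i.
move=> Mst wS; apply/norm_cvg0P.
have wE k : w k = M ^+ k *m w 0%N.
  by elim: k => [|k IH]; rewrite ?expr0 ?mul1mx // wS IH exprS -mulmxE mulmxA.
pose cM := complexify M; pose v := complexify (w 0%N).
have normE k : `|w k i 0| = normc ((horner_mx cM (1 * 'X^k) *m v) i 0).
  rewrite mul1r rmorphXn /= horner_mx_X /cM /complexify -rmorphXn -map_mxM -wE.
  by rewrite mxE normc_real.
rewrite (_ : (fun _ => _) =
  fun k => normc ((horner_mx cM (1 * 'X^k) *m v) i 0)); last exact/funext.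
have [r pE] := closed_field_poly_normal (char_poly cM).
move: pE; rewrite (monicP (char_poly_monic _)) scale1r => pE.
apply: (@horner_mx_factors_cvg0 _ _ _ _ _ r).
  apply/allP => z zr; rewrite -ltr_normc1; apply: Mst.
  by rewrite eigenvalue_root_char pE root_prod_XsubC.
rewrite -pE (_ : (fun _ => _) = fun=> 0); first exact: cvg_cst.
apply/funext => k; rewrite !rmorphM /= Cayley_Hamilton !mul0r mul0mx mxE.
exact: ComplexField.Normc.normc0.
Qed.

(** * Eigenvectors in real form *)

Definition cvec (R : rcfType) (n : nat) (a b : 'cV[R]_n) : 'cV[R[i]]_n :=
  \col_i Complex (a i 0) (b i 0).

Lemma cvec_inj (R : rcfType) (n : nat) (a b c d : 'cV[R]_n) :
  cvec a b = cvec c d -> a = c /\ b = d.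
Proof.
by move=> /matrixP h; split; apply/colP => i;
  have := h i 0; rewrite !mxE => -[].
Qed.

Lemma cvec_ReIm (R : rcfType) (n : nat) (v : 'cV[R[i]]_n) :
  v = cvec (map_mx (@complex.Re R) v) (map_mx (@complex.Im R) v).
Proof. by apply/colP => i; rewrite !mxE; case: (v i 0). Qed.

Lemma cvec_eq0 (R : rcfType) (n : nat) (a b : 'cV[R]_n) :
  cvec a b = 0 <-> a = 0 /\ b = 0.
Proof.
split=> [h|[-> ->]]; last by apply/colP => i; rewrite !mxE.
by apply: cvec_inj; rewrite h; apply/colP => i; rewrite !mxE.
Qed.

Lemma complexify_cvec (R : rcfType) (m n : nat) (M : 'M[R]_(m, n))
    (a b : 'cV[R]_n) :
  complexify M *m cvec a b = cvec (M *m a) (M *m b).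
Proof.
apply/colP => i; rewrite !mxE.
elim/big_rec3: _ => [|j x y _ _ ->]; first by [].
rewrite !mxE; apply/eqP; rewrite eq_complex /= !mul0r subr0 addr0.
by apply/andP; split; apply/eqP.
Qed.

Lemma scale_cvec (R : rcfType) (n : nat) (al be : R) (a b : 'cV[R]_n) :
  Complex al be *: cvec a b =
  cvec (al *: a - be *: b) (be *: a + al *: b).
Proof.
apply/colP => i; rewrite !mxE; apply/eqP.
rewrite eq_complex /= [X in _ && (_ == X)]addrC.
by apply/andP; split; apply/eqP.
Qed.

(** The equation M v = lambda v for v = a + i b and lambda = al + i be, split
    into real and imaginary parts.  In this form the estimates on real
    quadratic forms apply to eigenvectors without any Hermitian algebra. *)
Definition real_eigenpair (R : rcfType) (n : nat) (M : 'M[R]_n) (al be : R)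
    (a b : 'cV[R]_n) : Prop :=
  M *m a = al *: a - be *: b /\ M *m b = be *: a + al *: b.

Lemma real_eigenpairP (R : rcfType) (n : nat) (M : 'M[R]_n) (al be : R)
    (a b : 'cV[R]_n) :
  real_eigenpair M al be a b <->
  complexify M *m cvec a b = Complex al be *: cvec a b.
Proof.
rewrite complexify_cvec scale_cvec; split=> [[-> ->] //|h].
exact: cvec_inj.
Qed.

Lemma ler_normc1_sqr (R : rcfType) (al be : R) :
  (1 <= `|Complex al be|) = (1 <= al ^+ 2 + be ^+ 2).
Proof.
rewrite normr_normc -[1]/(real_complex R 1) lecR /=.
by rewrite -{1}sqrtr1 ler_sqrt // addr_ge0 ?sqr_ge0.
Qed.

(** Left and right eigenvectors have the same eigenvalues because M and its
    transpose have the same characteristic polynomial. *)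
Lemma eigenvalue_col (K : fieldType) (n : nat) (M : 'M[K]_n) (z : K) :
  eigenvalue M z <-> exists2 v : 'cV_n, v != 0 & M *m v = z *: v.
Proof.
have -> : eigenvalue M z = eigenvalue M^T z.
  rewrite !eigenvalue_root_char /char_poly -det_tr; congr (root (\det _) z).
  by rewrite /char_poly_mx linearB /= tr_scalar_mx map_trmx.
split=> [/eigenvalueP[v vM v0]|[v v0 vM]].
  exists v^T; first by rewrite trmx_eq0.
  by apply: trmx_inj; rewrite trmx_mul trmxK vM linearZ /= trmxK.
by apply/eigenvalueP; exists v^T; rewrite ?trmx_eq0 // -trmx_mul vM linearZ.
Qed.

Lemma stableP (R : rcfType) (n : nat) (M : 'M[R]_n) :
  stable M <->
  forall al be a b, 1 <= al ^+ 2 + be ^+ 2 ->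
    real_eigenpair M al be a b -> a = 0 /\ b = 0.
Proof.
split=> [Mst al be a b ab1 /real_eigenpairP h|h z /eigenvalue_col[v v0 vM]].
  apply/cvec_eq0/eqP; apply: contraT => v0.
  have /Mst : eigenvalue (complexify M) (Complex al be).
    by apply/eigenvalue_col; exists (cvec a b).
  by rewrite ltr_normc1 ltNge -ler_normc1 ler_normc1_sqr ab1.
rewrite ltr_normc1 ltNge -ler_normc1; apply: contra v0.
case: z vM => al be; rewrite [v]cvec_ReIm ler_normc1_sqr => /real_eigenpairP.
by move=> ab ab1; apply/eqP/cvec_eq0/(h _ _ _ _ ab1 ab).
Qed.

Lemma detectable_eigenpair (R : rcfType) (m n : nat) (C : 'M[R]_(m, n))
    (A : 'M[R]_n) (al be : R) (a b : 'cV[R]_n) :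
  detectable C A -> 1 <= al ^+ 2 + be ^+ 2 -> real_eigenpair A al be a b ->
  C *m a = 0 -> C *m b = 0 -> a = 0 /\ b = 0.
Proof.
move=> CA ab1 /real_eigenpairP h Ca Cb; apply/cvec_eq0/eqP.
apply: contraT => v0; rewrite -ler_normc1_sqr in ab1.
have := CA _ _ v0 h ab1; rewrite complexify_cvec Ca Cb.
by have [_ ->] := cvec_eq0 (0 : 'cV[R]_m) 0; rewrite ?eqxx.
Qed.

Lemma stable_neutral (R : rcfType) (n : nat) (A : 'M[R]_n) :
  neutrally_stable A -> nb_unit_eigenvalues A = 0%N -> stable A.
Proof.
move=> [le1 _] n0 z zA; rewrite lt_neqAle le1 // andbT.
apply/negP => z1; have zr : z \in eigenvalue_seq A.
  move: zA; rewrite eigenvalue_root_char /eigenvalue_seq.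
  case: closed_field_poly_normal => r /= ->.
  by rewrite (monicP (char_poly_monic _)) scale1r root_prod_XsubC.
suff : (0 < nb_unit_eigenvalues A)%N by rewrite n0.
by rewrite -has_count; apply/hasP; exists z.
Qed.

(** * The Euclidean inner product *)

Definition dot (R : rcfType) (n : nat) (u v : 'cV[R]_n) : R :=
  (u^T *m v) 0 0.

Definition sqnorm (R : rcfType) (n : nat) (v : 'cV[R]_n) : R := dot v v.

Definition energy (R : rcfType) (n : nat) (L : 'M[R]_n) (v : 'cV[R]_n) : R :=
  dot v (L *m v).

Lemma dotC (R : rcfType) (n : nat) (u v : 'cV[R]_n) : dot u v = dot v u.
Proof. by rewrite /dot -[u^T *m v]trmxK trmx_mul trmxK mxE. Qed.

Lemma dotDr (R : rcfType) (n : nat) (u v w : 'cV[R]_n) :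
  dot u (v + w) = dot u v + dot u w.
Proof. by rewrite /dot mulmxDr mxE. Qed.

Lemma dotZr (R : rcfType) (n : nat) (u v : 'cV[R]_n) (c : R) :
  dot u (c *: v) = c * dot u v.
Proof. by rewrite /dot -scalemxAr mxE. Qed.

Lemma dotNr (R : rcfType) (n : nat) (u v : 'cV[R]_n) :
  dot u (- v) = - dot u v.
Proof. by rewrite /dot mulmxN mxE. Qed.

Lemma dotDl (R : rcfType) (n : nat) (u v w : 'cV[R]_n) :
  dot (u + v) w = dot u w + dot v w.
Proof. by rewrite !(dotC _ w) dotDr. Qed.

Lemma dotZl (R : rcfType) (n : nat) (u v : 'cV[R]_n) (c : R) :
  dot (c *: u) v = c * dot u v.
Proof. by rewrite !(dotC _ v) dotZr. Qed.

Lemma dotNl (R : rcfType) (n : nat) (u v : 'cV[R]_n) :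
  dot (- u) v = - dot u v.
Proof. by rewrite !(dotC _ v) dotNr. Qed.

Definition dotE := (dotDl, dotDr, dotNl, dotNr, dotZl, dotZr).

Lemma dot_sumr (R : rcfType) (n q : nat) (u : 'cV[R]_n) (v : 'I_q -> 'cV[R]_n) :
  dot u (\sum_j v j) = \sum_j dot u (v j).
Proof. by rewrite /dot mulmx_sumr summxE. Qed.

Lemma dot_adjoint (R : rcfType) (m n : nat) (B : 'M[R]_(m, n))
    (u : 'cV[R]_m) (v : 'cV[R]_n) :
  dot u (B *m v) = dot (B^T *m u) v.
Proof. by rewrite /dot trmx_mul trmxK mulmxA. Qed.

Lemma sqnormE (R : rcfType) (n : nat) (v : 'cV[R]_n) :
  sqnorm v = \sum_i v i 0 ^+ 2.
Proof. by rewrite /sqnorm /dot mxE; apply: eq_bigr => i _; rewrite mxE expr2. Qed.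

Lemma sqnorm_ge0 (R : rcfType) (n : nat) (v : 'cV[R]_n) : 0 <= sqnorm v.
Proof. by rewrite sqnormE sumr_ge0 // => i _; apply: sqr_ge0. Qed.

Lemma sqnorm_eq0 (R : rcfType) (n : nat) (v : 'cV[R]_n) :
  sqnorm v = 0 -> v = 0.
Proof.
rewrite sqnormE => /eqP; rewrite psumr_eq0 => [/allP h|i _]; last exact: sqr_ge0.
apply/colP => i; rewrite mxE; apply/eqP; rewrite -sqrf_eq0.
exact: h (mem_index_enum i).
Qed.

Lemma sqnorm_orthogonal (R : rcfType) (n : nat) (Q : 'M[R]_n) (v : 'cV[R]_n) :
  orthogonal_mx Q -> sqnorm (Q *m v) = sqnorm v.
Proof. by move=> QQ; rewrite /sqnorm dot_adjoint mulmxA QQ mul1mx. Qed.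

Lemma dot_mxcol (R : rcfType) (q p : nat) (x y : 'I_q -> 'cV[R]_p) :
  dot (\mxcol_i x i) (\mxcol_i y i) = \sum_i dot (x i) (y i).
Proof. by rewrite /dot tr_mxcol mul_mxrow_mxcol summxE. Qed.

Lemma sqnorm_mxcol (R : rcfType) (q p : nat) (x : 'I_q -> 'cV[R]_p) :
  sqnorm (\mxcol_i x i) = \sum_i sqnorm (x i).
Proof. exact: dot_mxcol. Qed.

(** * Energy of a matrix-weighted Laplacian *)

(** A family of q vectors of size p is stacked into one vector of size
    \sum_(i < q) p by \mxcol, the block structure of [laplacian]. *)
Lemma mxcolZ (R : pzRingType) (q p : nat) (c : R) (x : 'I_q -> 'cV[R]_p) :
  \mxcol_i (c *: x i) = c *: \mxcol_i x i.
Proof. by apply/matrixP => i j; rewrite !mxE. Qed.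

(** The diagonal blocks of [laplacian] contain P i i, which no off-diagonal
    block compensates; hence the hypothesis. *)
Lemma laplacian_mxcol (R : rcfType) (q p : nat) (P : 'I_q -> 'I_q -> 'M[R]_p)
    (x : 'I_q -> 'cV[R]_p) :
  (forall i, P i i = 0) ->
  laplacian P *m (\mxcol_i x i) =
  \mxcol_i (\sum_j P i j *m (x i - x j)).
Proof.
move=> P0; rewrite /laplacian mxblockEv mxcol_mul; apply/eq_mxcol => i.
rewrite mul_mxrow_mxcol (bigD1 i) //= eqxx mulmx_suml [RHS](bigD1 i) //=.
rewrite P0 !mul0mx add0r [\sum_(_ < q) _](bigD1 i) //= P0 mul0mx add0r.
rewrite -big_split; apply: eq_bigr => j ji /=.
by rewrite eq_sym (negPf ji) mulNmx mulmxBr.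
Qed.

Lemma laplacian_sym (R : rcfType) (q p : nat) (P : 'I_q -> 'I_q -> 'M[R]_p) :
  (forall i j, (P i j)^T = P i j) -> (forall i j, P i j = P j i) ->
  (laplacian P)^T = laplacian P.
Proof.
move=> PT PS; rewrite /laplacian tr_mxblock; apply/eq_mxblock => i j.
rewrite eq_sym; case: eqP => [->|_]; last by rewrite linearN /= PT PS.
by rewrite linear_sum; apply: eq_bigr => l _; apply: PT.
Qed.

(** Exchanging i and j in the sum of the <x_i, P_ij (x_i - x_j)> and adding
    the two expressions makes the differences appear on both sides. *)
Lemma energy_laplacian (R : rcfType) (q p : nat)
    (P : 'I_q -> 'I_q -> 'M[R]_p) (x : 'I_q -> 'cV[R]_p) :
  (forall i, P i i = 0) -> (forall i j, P i j = P j i) ->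
  energy (laplacian P) (\mxcol_i x i) *+ 2 =
  \sum_i \sum_j energy (P i j) (x i - x j).
Proof.
move=> P0 PS; rewrite /energy laplacian_mxcol // dot_mxcol.
under eq_bigr do rewrite dot_sumr.
rewrite mulr2n {2}exchange_big -big_split; apply: eq_bigr => i _ /=.
rewrite -big_split; apply: eq_bigr => j _ /=.
by rewrite (PS j i) -(opprB (x i)) mulmxN dotDl dotNr dotNl.
Qed.

Lemma energy_gram (R : rcfType) (m n : nat) (B : 'M[R]_(m, n)) (v : 'cV[R]_n) :
  energy (B^T *m B) v = sqnorm (B *m v).
Proof. by rewrite /energy /sqnorm dot_adjoint trmx_mul trmxK -mulmxA dot_adjoint. Qed.

(** A step of size eps along the gradient of half the energy decreases the norm:
    the second-order term eps^2 |L v|^2 is absorbed by half of the first-order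
    term 2 eps <v, L v>, as epsbar |L v|^2 <= <v, L v>. *)
Lemma gradient_step_sqnorm (R : rcfType) (n : nat) (L : 'M[R]_n)
    (eps epsbar : R) (v : 'cV[R]_n) :
  L^T = L -> psd (L - epsbar *: (L *m L)) -> 0 < eps -> eps <= epsbar ->
  sqnorm (v - eps *: (L *m v)) <= sqnorm v - eps * energy L v.
Proof.
move=> LT [_ /(_ v)] + eps0 epsle.
have -> : (v^T *m (L - epsbar *: (L *m L)) *m v) 0 0 =
    energy L v - epsbar * sqnorm (L *m v).
  rewrite -mulmxA -[LHS]/(dot v _) mulmxBl -scalemxAl -mulmxA !dotE.
  by rewrite [dot v (L *m (L *m v))]dot_adjoint LT.
rewrite subr_ge0 => Lv.
have : eps * (eps * sqnorm (L *m v)) <= eps * energy L v.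
  rewrite ler_pM2l //; apply: le_trans Lv.
  by rewrite ler_wpM2r // sqnorm_ge0.
rewrite /energy /sqnorm !dotE (dotC (L *m v) v); lra.
Qed.

Lemma energy_laplacian_gram (R : rcfType) (q p : nat)
    (m : 'I_q -> 'I_q -> nat) (B : forall i j, 'M[R]_(m i j, p))
    (x : 'I_q -> 'cV[R]_p) :
  (forall i, B i i = 0) ->
  (forall i j, (B i j)^T *m B i j = (B j i)^T *m B j i) ->
  energy (laplacian (fun i j => (B i j)^T *m B i j)) (\mxcol_i x i) *+ 2 =
  \sum_i \sum_j sqnorm (B i j *m (x i - x j)).
Proof.
move=> B0 BS; rewrite energy_laplacian // => [|i]; last by rewrite B0 mulmx0.
by apply: eq_bigr => i _; apply: eq_bigr => j _; rewrite energy_gram.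
Qed.

(** |lambda v|^2 = |lambda|^2 |v|^2 in real form. *)
Lemma sqnorm_rotation (R : rcfType) (n : nat) (al be : R) (a b : 'cV[R]_n) :
  sqnorm (al *: a - be *: b) + sqnorm (be *: a + al *: b) =
  (al ^+ 2 + be ^+ 2) * (sqnorm a + sqnorm b).
Proof. by rewrite /sqnorm !dotE (dotC b a); ring. Qed.

(** lambda v = 0 with |lambda| >= 1 forces v = 0, in real form. *)
Lemma rotation_eq0 (R : rcfType) (n : nat) (al be : R) (a b : 'cV[R]_n) :
  1 <= al ^+ 2 + be ^+ 2 -> al *: a - be *: b = 0 -> be *: a + al *: b = 0 ->
  a = 0 /\ b = 0.
Proof.
move=> ab1 ea eb; have := sqnorm_rotation al be a b.
rewrite ea eb {1 2}/sqnorm /dot !mulmx0 mxE addr0 => /esym/eqP.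
rewrite mulf_eq0 [X in _ || X]paddr_eq0 ?sqnorm_ge0 // => /orP[/eqP|/andP[/eqP a0 /eqP b0]].
  by move=> ab0; move: ab1; rewrite ab0 ler10.
by split; apply: sqnorm_eq0.
Qed.

(** The gradient step cannot increase the norm while an eigenvalue of modulus
    at least 1 cannot decrease it, so the dissipated energy is zero.  The
    eigenvector equation is only assumed up to an isometry, which leaves room
    for the rotation Q that follows the gradient step. *)
Lemma unstable_mode_energy0 (R : rcfType) (n : nat) (L : 'M[R]_n)
    (eps epsbar al be : R) (a b : 'cV[R]_n) :
  L^T = L -> (forall v, 0 <= energy L v) ->
  psd (L - epsbar *: (L *m L)) -> 0 < eps -> eps <= epsbar ->
  1 <= al ^+ 2 + be ^+ 2 ->
  sqnorm (a - eps *: (L *m a)) = sqnorm (al *: a - be *: b) ->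
  sqnorm (b - eps *: (L *m b)) = sqnorm (be *: a + al *: b) ->
  energy L a = 0 /\ energy L b = 0.
Proof.
move=> LT L0 psdL eps0 epsle ab1 ea eb.
have rot := sqnorm_rotation al be a b.
have ha := gradient_step_sqnorm a LT psdL eps0 epsle.
have hb := gradient_step_sqnorm b LT psdL eps0 epsle.
have grow : sqnorm a + sqnorm b <= (al ^+ 2 + be ^+ 2) * (sqnorm a + sqnorm b).
  by rewrite ler_peMl // addr_ge0 // sqnorm_ge0.
have : eps * (energy L a + energy L b) <= 0 by lra.
rewrite pmulr_rle0 // => le0.
by have := L0 a; have := L0 b; split; lra.
Qed.

(** In an eigenvector of the synchronized rotation composed with a gradient
    step, for an eigenvalue of modulus at least 1, no edge dissipates energy:
    the neighbours produce the same output. *)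
Lemma laplacian_unstable_mode (R : rcfType) (q p : nat)
    (m : 'I_q -> 'I_q -> nat) (B : forall i j, 'M[R]_(m i j, p))
    (Q : 'M[R]_p) (eps epsbar al be : R) (a b : 'I_q -> 'cV[R]_p)
    (P := fun i j => (B i j)^T *m B i j) :
  (forall i, B i i = 0) -> (forall i j, P i j = P j i) ->
  orthogonal_mx Q ->
  psd (laplacian P - epsbar *: (laplacian P *m laplacian P)) ->
  0 < eps -> eps <= epsbar -> 1 <= al ^+ 2 + be ^+ 2 ->
  (forall i, Q *m (a i - eps *: (\sum_j P i j *m (a i - a j))) =
     al *: a i - be *: b i) ->
  (forall i, Q *m (b i - eps *: (\sum_j P i j *m (b i - b j))) =
     be *: a i + al *: b i) ->
  forall i j, B i j *m (a i - a j) = 0 /\ B i j *m (b i - b j) = 0.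
Proof.
move=> B0 PS QQ psdL eps0 epsle ab1 ea eb.
have P0 i : P i i = 0 by rewrite /P B0 mulmx0.
have LT : (laplacian P)^T = laplacian P.
  by apply: laplacian_sym => // i j; rewrite /P trmx_mul trmxK.
have L2 x : energy (laplacian P) (\mxcol_i x i) *+ 2 =
    \sum_i \sum_j sqnorm (B i j *m (x i - x j)).
  exact: energy_laplacian_gram.
have L0 v : 0 <= energy (laplacian P) v.
  rewrite -(pmulrn_lge0 _ (isT : (0 < 2)%N)) -(submxcolK v) L2.
  by do 2! apply: sumr_ge0 => ? _; apply: sqnorm_ge0.
have step x y : (forall i, Q *m (x i - eps *: (\sum_j P i j *m (x i - x j))) =
      y i) ->
    sqnorm (\mxcol_i x i - eps *: (laplacian P *m \mxcol_i x i)) =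
    sqnorm (\mxcol_i y i).
  move=> xy; rewrite laplacian_mxcol // -mxcolZ -mxcolB !sqnorm_mxcol.
  by apply: eq_bigr => i _; rewrite -xy sqnorm_orthogonal.
have [Ea Eb] : energy (laplacian P) (\mxcol_i a i) = 0 /\
    energy (laplacian P) (\mxcol_i b i) = 0.
  apply: (unstable_mode_energy0 LT L0 psdL eps0 epsle ab1).
    by rewrite (step _ _ ea) mxcolB !mxcolZ.
  by rewrite (step _ _ eb) mxcolD !mxcolZ.
have edge x : energy (laplacian P) (\mxcol_i x i) = 0 ->
    forall i j, B i j *m (x i - x j) = 0.
  move=> E0 i j; have := L2 x; rewrite E0 mul0rn => /esym/eqP.
  rewrite psumr_eq0 => [/allP/(_ i (mem_index_enum i))/=|k _]; last first.
    by apply: sumr_ge0 => l _; apply: sqnorm_ge0.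
  rewrite psumr_eq0 => [/allP/(_ j (mem_index_enum j))/=|l _]; last first.
    exact: sqnorm_ge0.
  by move=> /eqP/sqnorm_eq0.
by move=> i j; split; apply: edge.
Qed.

(** * The disagreement dynamics *)

(** The coupled dynamics followed by the removal of the mean, the mean after
    one step being q^-1 times the sum of the A x_j.  It coincides with the
    coupled dynamics on stacks of zero sum.  Unlike the coupled dynamics it
    has no consensus modes, which makes it stable as a whole; no restriction
    to the subspace of zero-sum stacks is needed. *)
Definition disagreement_mx (R : rcfType) (q n : nat) (A : 'M[R]_n)
    (K : 'I_q -> 'I_q -> 'M[R]_n) (eps : R) : 'M[R]_(\sum_(i < q) n) :=
  \mxdiag_(i < q) A - eps *: laplacian K -
  \mxblock_(i < q, j < q) (q%:R^-1 *: A).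

Lemma disagreement_mx_mxcol (R : rcfType) (q n : nat) (A : 'M[R]_n)
    (K : 'I_q -> 'I_q -> 'M[R]_n) (eps : R) (d : 'I_q -> 'cV[R]_n) :
  (forall i, K i i = 0) ->
  disagreement_mx A K eps *m (\mxcol_i d i) =
  \mxcol_i (A *m d i - eps *: (\sum_j K i j *m (d i - d j)) -
            q%:R^-1 *: (A *m \sum_j d j)).
Proof.
move=> K0; rewrite /disagreement_mx !mulmxBl -scalemxAl laplacian_mxcol //.
rewrite mul_mxdiag_mxcol mxblockEv mxcol_mul -mxcolZ -!mxcolB.
apply/eq_mxcol => i; congr (_ - _).
rewrite mul_mxrow_mxcol mulmx_sumr scaler_sumr.
by apply: eq_bigr => j _; rewrite -scalemxAl.
Qed.

Lemma sum_coupling0 (R : rcfType) (q n : nat) (K : 'I_q -> 'I_q -> 'M[R]_n)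
    (x : 'I_q -> 'cV[R]_n) :
  (forall i j, K i j = K j i) -> \sum_i \sum_j K i j *m (x i - x j) = 0.
Proof.
move=> KS; set S := LHS; have : S *+ 2 = 0.
  rewrite mulr2n {2}/S exchange_big -big_split big1 //= => i _.
  rewrite -big_split big1 //= => j _.
  by rewrite (KS j i) -mulmxDr -(opprB (x i)) subrr mulmx0.
move=> S0; apply/colP => i; move/colP/(_ i): S0; rewrite mulmxnE !mxE => /eqP.
by rewrite mulrn_eq0 => /eqP.
Qed.

Lemma sum_disagreement (R : rcfType) (q n : nat) (A : 'M[R]_n)
    (K : 'I_q -> 'I_q -> 'M[R]_n) (eps : R) (d : 'I_q -> 'cV[R]_n) :
  (0 < q)%N -> (forall i j, K i j = K j i) ->
  \sum_i (A *m d i - eps *: (\sum_j K i j *m (d i - d j)) -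
          q%:R^-1 *: (A *m \sum_j d j)) = 0.
Proof.
move=> q0 KS; rewrite !big_split /= !sumrN -scaler_sumr sum_coupling0 //.
rewrite scaler0 subr0 -mulmx_sumr sumr_const card_ord -scaler_nat scalerA.
by rewrite divff ?pnatr_eq0 -?lt0n // scale1r subrr.
Qed.

Lemma connect_eq (T : finType) (V : Type) (e : rel T) (f : T -> V) :
  connected_graph e -> (forall i j, e i j -> f i = f j) ->
  forall i j, f i = f j.
Proof.
move=> conn fe i j; have /connectP[s + ->] := conn i j.
by elim: s i => [//|k s IH] i /= /andP[/fe -> /IH].
Qed.

(** The two blocks of rows Y and Z of the inverse of [row_mx U W] extract the
    coordinates along the orthogonal block Q and the stable block F. *)
Definition modal_splitting (K : fieldType) (n n1 n2 : nat) (A : 'M[K]_n)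
    (U : 'M[K]_(n, n1)) (W : 'M[K]_(n, n2)) (Q : 'M[K]_n1) (F : 'M[K]_n2)
    (Y : 'M[K]_(n1, n)) (Z : 'M[K]_(n2, n)) : Prop :=
  [/\ A *m U = U *m Q, A *m W = W *m F, U *m Y + W *m Z = 1%:M &
   [/\ Y *m U = 1%:M, Y *m W = 0, Z *m U = 0 & Z *m W = 1%:M]].

Lemma block_similarity (K : fieldType) (n1 n2 : nat) (A : 'M[K]_(n1 + n2))
    (U : 'M[K]_(n1 + n2, n1)) (W : 'M[K]_(n1 + n2, n2)) (Q : 'M[K]_n1)
    (F : 'M[K]_n2) (V := invmx (row_mx U W)) (Y := usubmx V) (Z := dsubmx V) :
  row_mx U W \in unitmx -> V *m A *m row_mx U W = block_mx Q 0 0 F ->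
  modal_splitting A U W Q F Y Z.
Proof.
move=> UWu /(congr1 (mulmx (row_mx U W))).
rewrite -mulmxA mulKVmx // mul_mx_row mul_row_block !mulmx0 addr0 add0r.
case/eq_row_mx => AU AW; split => //.
  by rewrite -mul_row_col vsubmxK mulmxV.
have : col_mx Y Z *m row_mx U W = 1%:M by rewrite vsubmxK mulVmx.
by rewrite mul_col_row scalar_mx_block => /eq_block_mx[].
Qed.

(** The coordinates extracted by Y and Z evolve independently. *)
Lemma left_modes (K : fieldType) (n n1 n2 : nat) (A : 'M[K]_n)
    (U : 'M[K]_(n, n1)) (W : 'M[K]_(n, n2)) (Q : 'M[K]_n1) (F : 'M[K]_n2)
    (Y : 'M[K]_(n1, n)) (Z : 'M[K]_(n2, n)) :
  modal_splitting A U W Q F Y Z -> Y *m A = Q *m Y /\ Z *m A = F *m Z.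
Proof.
move=> [AU AW UYWZ [YU YW ZU ZW]].
rewrite -(mulmx1 A) -UYWZ mulmxDr !mulmxA AU AW !mulmxDr !mulmxA.
by rewrite YU YW ZU ZW !mul1mx !mul0mx addr0 add0r.
Qed.

(** The eigenvector argument outlined at the top.  For an eigenvector given by
    the stacks a and b of its real and imaginary parts: both sums are zero
    because T removes the mean; the F components vanish by stability of F; the
    Q components dissipate no energy; detectability and connectedness then
    leave only the consensus vectors, whose sum is q times each component. *)
Lemma disagreement_stable (R : rcfType) (q n n1 n2 : nat)
    (m : 'I_q -> 'I_q -> nat) (A : 'M[R]_n) (C : forall i j, 'M[R]_(m i j, n))
    (U : 'M[R]_(n, n1)) (W : 'M[R]_(n, n2)) (Q : 'M[R]_n1) (F : 'M[R]_n2)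
    (Y : 'M[R]_(n1, n)) (Z : 'M[R]_(n2, n)) (K : 'I_q -> 'I_q -> 'M[R]_n)
    (eps epsbar : R)
    (P := fun i j => U^T *m (C i j)^T *m C i j *m U) :
  modal_splitting A U W Q F Y Z ->
  (forall i, C i i = 0) ->
  (forall i j, (C i j)^T *m C i j = (C j i)^T *m C j i) ->
  connected_graph (coupling_graph C) ->
  (forall i j, C i j != 0 -> detectable (C i j) A) ->
  orthogonal_mx Q -> stable F ->
  (forall i j, K i j = U *m Q *m U^T *m (C i j)^T *m C i j) ->
  psd (laplacian P - epsbar *: (laplacian P *m laplacian P)) ->
  0 < eps -> eps <= epsbar ->
  stable (disagreement_mx A K eps).
Proof.
move=> split_A C0 CS conn det QQ /stableP Fst KE psdL eps0 epsle.
have [YA ZA] := left_modes split_A.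
have [AU AW UYWZ [YU YW ZU ZW]] := split_A.
have K0 i : K i i = 0 by rewrite KE C0 mulmx0.
have KS i j : K i j = K j i by rewrite !KE -!mulmxA CS.
apply/stableP => al be a' b' ab1.
rewrite -(submxcolK a') -(submxcolK b').
pose a i := submxcol a' i; pose b i := submxcol b' i.
rewrite -[X in real_eigenpair _ _ _ X]/(\mxcol_i a i).
rewrite -[X in real_eigenpair _ _ _ _ X]/(\mxcol_i b i).
rewrite /real_eigenpair !disagreement_mx_mxcol // -!mxcolZ -mxcolB -mxcolD.
move=> [/eq_mxcolP ea /eq_mxcolP eb].
suff ab0 i : a i = 0 /\ b i = 0.
  by split; apply/mxcolP => i; rewrite mxcolK submxcol0; have [] := ab0 i.
have q0 : (0 < q)%N by apply: leq_ltn_trans (ltn_ord i).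
have [sa sb] : \sum_i a i = 0 /\ \sum_i b i = 0.
  apply: (rotation_eq0 ab1).
    rewrite !scaler_sumr -sumrB -(eq_bigr _ (fun i _ => ea i)).
    exact: sum_disagreement.
  rewrite !scaler_sumr -big_split -(eq_bigr _ (fun i _ => eb i)).
  exact: sum_disagreement.
have {}ea k : A *m a k - eps *: (\sum_j K k j *m (a k - a j)) =
    al *: a k - be *: b k by rewrite -ea sa mulmx0 scaler0 subr0.
have {}eb k : A *m b k - eps *: (\sum_j K k j *m (b k - b j)) =
    be *: a k + al *: b k by rewrite -eb sb mulmx0 scaler0 subr0.
(* The gains take values in the range of U, which Z annihilates. *)
have ZK k (x : 'I_q -> 'cV[R]_n) : Z *m (\sum_j K k j *m (x k - x j)) = 0.
  by rewrite mulmx_sumr big1 // => j _; rewrite KE !mulmxA ZU !mul0mx.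
have Zab k : Z *m a k = 0 /\ Z *m b k = 0.
  apply: (Fst _ _ _ _ ab1); split; rewrite !mulmxA -ZA -mulmxA.
    by rewrite !scalemxAr -mulmxBr -ea mulmxBr -scalemxAr ZK scaler0 subr0.
  by rewrite !scalemxAr -mulmxDr -eb mulmxBr -scalemxAr ZK scaler0 subr0.
(* Only the Q components are left, so each a k is recovered from Y *m a k. *)
have UYE (x : 'cV[R]_n) : Z *m x = 0 -> U *m (Y *m x) = x.
  by move=> Zx; rewrite -[RHS]mul1mx -UYWZ mulmxDl -!mulmxA Zx mulmx0 addr0.
pose B i j := C i j *m U.
have PE k j : P k j = (B k j)^T *m B k j by rewrite /B trmx_mul !mulmxA.
have YE k (x : 'I_q -> 'cV[R]_n) : (forall j, Z *m x j = 0) ->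
    Y *m (A *m x k - eps *: (\sum_j K k j *m (x k - x j))) =
    Q *m (Y *m x k - eps *: (\sum_j (B k j)^T *m B k j *m
      (Y *m x k - Y *m x j))).
  move=> Zx; rewrite !mulmxBr mulmxA YA -mulmxA -!scalemxAr; congr (_ - _ *: _).
  rewrite !mulmx_sumr; apply: eq_bigr => j _.
  rewrite KE -PE /P -mulmxBr -!mulmxA (UYE (x k - x j)); last first.
    by rewrite mulmxBr !Zx subrr.
  by rewrite !mulmxA YU mul1mx.
have PL : laplacian P = laplacian (fun i j => (B i j)^T *m B i j).
  by congr laplacian; apply/funext => k; apply/funext => j; apply: PE.
have BU k j : B k j *m (Y *m a k - Y *m a j) = 0 /\
    B k j *m (Y *m b k - Y *m b j) = 0.
  rewrite PL in psdL.
  apply: (laplacian_unstable_mode (B := B) (Q := Q) (a := fun i => Y *m a i)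
    (b := fun i => Y *m b i) _ _ QQ psdL eps0 epsle ab1).
  - by move=> l; rewrite /B C0 mul0mx.
  - by move=> l l'; rewrite -!PE /P -(mulmxA U^T) CS mulmxA.
  - move=> l; rewrite -YE; last by move=> l'; have [] := Zab l'.
    by rewrite ea mulmxBr !scalemxAr.
  - move=> l; rewrite -YE; last by move=> l'; have [] := Zab l'.
    by rewrite eb mulmxDr !scalemxAr.
have Cab k j : C k j *m (a k - a j) = 0 /\ C k j *m (b k - b j) = 0.
  have := BU k j; rewrite -!mulmxBr /B -!mulmxA !UYE //.
    by rewrite mulmxBr !(proj2 (Zab _)) subrr.
  by rewrite mulmxBr !(proj1 (Zab _)) subrr.
(* No coupling acts along the eigenvector, so that its components are modes of
   the uncoupled matrix A. *)
have KC k (x : 'I_q -> 'cV[R]_n) : (forall j, C k j *m (x k - x j) = 0) ->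
    \sum_j K k j *m (x k - x j) = 0.
  by move=> Cx; apply: big1 => j _; rewrite KE -mulmxA Cx mulmx0.
have Aa k : A *m a k = al *: a k - be *: b k.
  by rewrite -ea KC ?scaler0 ?subr0 // => j; have [] := Cab k j.
have Ab k : A *m b k = be *: a k + al *: b k.
  by rewrite -eb KC ?scaler0 ?subr0 // => j; have [] := Cab k j.
have edge j k : coupling_graph C j k -> (a j, b j) = (a k, b k).
  move=> /det/detectable_eigenpair; move/(_ _ _ _ _ ab1).
  move/(_ (a k - a j) (b k - b j)).
  have [Ca Cb] := Cab k j; case => //.
    split; rewrite mulmxBr ?Aa ?Ab !scalerBr; first by rewrite !opprD addrACA.
    by rewrite opprD addrACA.
  by move=> /eqP + /eqP; rewrite !subr_eq0 => /eqP -> /eqP ->.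
have all_eq j : (a j, b j) = (a i, b i) by apply: (connect_eq conn edge).
have qn0 : q%:R != 0 :> R by rewrite pnatr_eq0 -lt0n.
split.
  move: sa; rewrite (eq_bigr (fun=> a i)) => [|j _]; last by case: (all_eq j).
  rewrite sumr_const card_ord -scaler_nat => /eqP.
  by rewrite scaler_eq0 (negPf qn0) => /eqP.
move: sb; rewrite (eq_bigr (fun=> b i)) => [|j _]; last by case: (all_eq j).
rewrite sumr_const card_ord -scaler_nat => /eqP.
by rewrite scaler_eq0 (negPf qn0) => /eqP.
Qed.

(** * Mean, deviations and boundedness *)

Definition mean (R : rcfType) (q n : nat) (x : 'I_q -> 'cV[R]_n) : 'cV[R]_n :=
  q%:R^-1 *: \sum_i x i.

Lemma mean_solution (R : rcfType) (q n : nat) (m : 'I_q -> 'I_q -> nat)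
    (A : 'M[R]_n) (C : forall i j, 'M[R]_(m i j, n))
    (G : forall i j, 'M[R]_(n, m i j)) (eps : R)
    (x : nat -> 'I_q -> 'cV[R]_n) :
  (forall i j, G i j *m C i j = G j i *m C j i) -> is_solution A C G eps x ->
  forall k, mean (x k.+1) = A *m mean (x k).
Proof.
move=> GCS sol k; rewrite /mean -scalemxAr; congr (_ *: _).
rewrite (eq_bigr _ (fun i _ => sol k i)) big_split /= -mulmx_sumr.
rewrite -scaler_sumr.
have -> : \sum_i \sum_j G i j *m C i j *m (x k j - x k i) =
    - \sum_i \sum_j G i j *m C i j *m (x k i - x k j).
  rewrite -sumrN; apply: eq_bigr => i _; rewrite -sumrN.
  by apply: eq_bigr => j _; rewrite -mulmxN opprB.
by rewrite (sum_coupling0 (K := fun i j => G i j *m C i j)) // oppr0 scaler0 addr0.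
Qed.

(** The mean of a solution follows A alone, so the stack of the deviations is
    a trajectory of [disagreement_mx]. *)
Lemma deviation_cvg0 (R : realType) (q n : nat) (m : 'I_q -> 'I_q -> nat)
    (A : 'M[R]_n) (C : forall i j, 'M[R]_(m i j, n))
    (G : forall i j, 'M[R]_(n, m i j)) (eps : R)
    (x : nat -> 'I_q -> 'cV[R]_n) :
  (forall i, C i i = 0) -> (forall i j, G i j *m C i j = G j i *m C j i) ->
  stable (disagreement_mx A (fun i j => G i j *m C i j) eps) ->
  is_solution A C G eps x ->
  forall i l, ((fun k => (x k i - mean (x k)) l 0) @ \oo --> (0 : R))%classic.
Proof.
move=> C0 GCS Tst sol i l; set K := fun i j => G i j *m C i j in Tst.
pose d k i := x k i - mean (x k).
have qn0 : q%:R != 0 :> R.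
  by rewrite pnatr_eq0 -lt0n; apply: leq_ltn_trans (ltn_ord i).
have d0 k : \sum_j d k j = 0.
  rewrite sumrB sumr_const card_ord -scaler_nat /mean scalerA divff //.
  by rewrite scale1r subrr.
have dS k : \mxcol_i d k.+1 i = disagreement_mx A K eps *m \mxcol_i d k i.
  rewrite disagreement_mx_mxcol => [|j]; last by rewrite /K C0 mulmx0.
  apply/eq_mxcol => j; rewrite d0 mulmx0 scaler0 subr0 /d.
  rewrite (mean_solution GCS sol).
  rewrite sol mulmxBr addrAC; congr (_ + _); rewrite -scalerN -sumrN.
  congr (_ *: _); apply: eq_bigr => p _.
  by rewrite opprB addrA subrK -mulmxN opprB.
have dE k : (x k i - mean (x k)) l 0 = (\mxcol_i d k i) (tagnat.Rank i l) 0.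
  by have /colP/(_ l) := mxcolK (d k) i; rewrite mxE => ->.
by under eq_fun do rewrite dE; apply: stable_cvg0 Tst dS.
Qed.

Lemma euclidean_norm_cvg0 (R : realType) (n : nat) (w : nat -> 'cV[R]_n) :
  (forall l, ((fun k => w k l 0) @ \oo --> (0 : R))%classic) ->
  ((fun k => euclidean_norm (w k)) @ \oo --> (0 : R))%classic.
Proof.
move=> w0.
have : ((fun k => \sum_(l < n) w k l 0 ^+ 2) @ \oo -->
    \sum_(l < n) (0 : R) * 0)%classic.
  apply: (cvg_big (@add_continuous R)) => l _.
  by under eq_fun do rewrite expr2; apply: cvgM.
rewrite [X in (_ --> X)%classic]big1 => [sum0|l _]; last by rewrite mul0r.
by have := cvg_comp _ _ sum0 (@sqrt_continuous R 0); rewrite sqrtr0.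
Qed.

(** Boundedness as an explicit inequality, stable under the finite sums and
    products of entries that make up matrix products and squared norms. *)
Definition bounded_seq (R : rcfType) (u : nat -> R) : Prop :=
  exists M : R, forall k, `|u k| <= M.

Lemma bounded_seqD (R : rcfType) (u v : nat -> R) :
  bounded_seq u -> bounded_seq v -> bounded_seq (fun k => u k + v k).
Proof.
move=> [M uM] [N vN]; exists (M + N) => k.
by apply: le_trans (ler_normD _ _) _; apply: lerD.
Qed.

Lemma bounded_seqM (R : rcfType) (u v : nat -> R) :
  bounded_seq u -> bounded_seq v -> bounded_seq (fun k => u k * v k).
Proof.
by move=> [M uM] [N vN]; exists (M * N) => k; rewrite normrM ler_pM.
Qed.

Lemma bounded_seq_cst (R : rcfType) (c : R) : bounded_seq (fun=> c).
Proof. by exists `|c|. Qed.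

Lemma bounded_seq_sum (R : rcfType) (p : nat) (u : 'I_p -> nat -> R) :
  (forall l, bounded_seq (u l)) -> bounded_seq (fun k => \sum_l u l k).
Proof.
move=> ub; elim: (index_enum _) => [|l s IH].
  by under eq_fun do rewrite big_nil; apply: bounded_seq_cst.
by under eq_fun do rewrite big_cons; apply: bounded_seqD.
Qed.

Lemma cvg_bounded_seq (R : realType) (u : nat -> R) (l : R) :
  (u @ \oo --> l)%classic -> bounded_seq u.
Proof.
move=> ul; have [M [_ Mu]] : bounded_fun u.
  by apply: cvg_seq_bounded; apply/cvg_ex; exists l.
by exists (M + 1) => k; apply: Mu => //; rewrite ltrDl.
Qed.

Definition bounded_vec (R : rcfType) (n : nat) (w : nat -> 'cV[R]_n) : Prop :=
  forall l, bounded_seq (fun k => w k l 0).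

Lemma bounded_vecD (R : rcfType) (n : nat) (v w : nat -> 'cV[R]_n) :
  bounded_vec v -> bounded_vec w -> bounded_vec (fun k => v k + w k).
Proof.
by move=> vb wb l; under eq_fun do rewrite mxE; apply: bounded_seqD.
Qed.

Lemma bounded_vec_mulmx (R : rcfType) (m n : nat) (B : 'M[R]_(m, n))
    (w : nat -> 'cV[R]_n) :
  bounded_vec w -> bounded_vec (fun k => B *m w k).
Proof.
move=> wb l; under eq_fun do rewrite mxE.
apply: bounded_seq_sum => j; apply: bounded_seqM (wb j).
exact: bounded_seq_cst.
Qed.

Lemma orthogonal_bounded (R : rcfType) (n : nat) (Q : 'M[R]_n)
    (w : nat -> 'cV[R]_n) :
  orthogonal_mx Q -> (forall k, w k.+1 = Q *m w k) -> bounded_vec w.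
Proof.
move=> QQ wS l; exists (Num.sqrt (sqnorm (w 0%N))) => k.
have <- : sqnorm (w k) = sqnorm (w 0%N).
  by elim: k => // k IH; rewrite wS sqnorm_orthogonal.
rewrite -sqrtr_sqr ler_wsqrtr // sqnormE (bigD1 l) //= lerDl.
by apply: sumr_ge0 => j _; apply: sqr_ge0.
Qed.

Lemma bounded_trajectories_vec (R : rcfType) (q n : nat)
    (x : nat -> 'I_q -> 'cV[R]_n) :
  (forall i, bounded_vec (fun k => x k i)) -> bounded_trajectories x.
Proof.
move=> xb; have [M xM] : bounded_seq (fun k => \sum_i sqnorm (x k i)).
  apply: bounded_seq_sum => i; under eq_fun do rewrite sqnormE.
  apply: bounded_seq_sum => l; under eq_fun do rewrite expr2.
  by apply: bounded_seqM; apply: xb.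
exists (Num.sqrt M) => k i; rewrite /euclidean_norm -sqnormE ler_wsqrtr //.
apply: le_trans (xM k); apply: le_trans (ler_norm _).
rewrite (bigD1 i) //= lerDl; apply: sumr_ge0 => j _; exact: sqnorm_ge0.
Qed.

(** Common end of both cases of the theorem: the reference c is the mean of
    the solution when A has eigenvalues on the unit circle, and 0 when A is
    stable. *)
Lemma tracking (R : realType) (q n : nat) (x : nat -> 'I_q -> 'cV[R]_n)
    (c : nat -> 'cV[R]_n) :
  (forall i l, ((fun k => (x k i - c k) l 0) @ \oo --> (0 : R))%classic) ->
  bounded_vec c ->
  (forall i j, ((fun k => euclidean_norm (x k i - x k j)) @ \oo
     --> (0 : R))%classic) /\ bounded_trajectories x.
Proof.
move=> xc cb; split=> [i j|].
  apply: euclidean_norm_cvg0 => l.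
  have -> : (fun k => (x k i - x k j) l 0) =
      (fun k => (x k i - c k) l 0 - (x k j - c k) l 0).
    by apply/funext => k; rewrite !mxE; ring.
  by rewrite -[X in (_ --> X)%classic](subr0 (0 : R)); apply: cvgB.
apply: bounded_trajectories_vec => i.
have -> : (fun k => x k i) = (fun k => (x k i - c k) + c k).
  by apply/funext => k; rewrite subrK.
by apply: bounded_vecD => // l; apply: cvg_bounded_seq (xc i l).
Qed.

Lemma gram_castmx (R : rcfType) (m m' n : nat) (e : m = m')
    (B : 'M[R]_(m, n)) (B' : 'M[R]_(m', n)) :
  castmx (e, erefl n) B = B' -> B^T *m B = B'^T *m B'.
Proof. by case: m' / e B' => B'; rewrite castmx_id => ->. Qed.

Theorem theorem3 (R : realType) (q n n1 n2 : nat) (m : 'I_q -> 'I_q -> nat)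
    (A : 'M[R]_n) (C : forall i j : 'I_q, 'M[R]_(m i j, n))
    (G : forall i j : 'I_q, 'M[R]_(n, m i j))
    (U : 'M[R]_(n, n1)) (W : 'M[R]_(n, n2)) (Q : 'M[R]_n1) (F : 'M[R]_n2)
    (epsbar : R)
    (C_diag : forall i, C i i = 0)
    (m_sym : forall i j, m i j = m j i)
    (C_sym : forall i j, castmx (m_sym i j, erefl n) (C i j) = C j i)
    (C_connected : connected_graph (coupling_graph C))
    (A_neutral : neutrally_stable A)
    (CA_detectable : forall i j, C i j != 0 -> detectable (C i j) A)
    (n1E : n1 = nb_unit_eigenvalues A)
    (n12 : (n1 + n2)%N = n)
    (gains0 : n1 = 0%N -> forall i j, G i j = 0)
    (gains_gt0 : (0 < n1)%N ->
      let UW : 'M[R]_n := castmx (erefl n, n12) (row_mx U W) in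
      [/\ UW \in unitmx,
          invmx UW *m A *m UW = castmx (n12, n12) (block_mx Q 0 0 F),
          orthogonal_mx Q,
          stable F &
          forall i j, G i j = U *m Q *m U^T *m (C i j)^T])
    (epsbar_gt0 : 0 < epsbar)
    (epsbar_laplacian : (0 < n1)%N ->
      let L := laplacian (fun i j => U^T *m (C i j)^T *m C i j *m U) in
      psd (L - epsbar *: (L *m L))) :
  forall eps : R, 0 < eps -> eps <= epsbar ->
    synchronize A C G eps /\
    forall x : nat -> 'I_q -> 'cV[R]_n,
      is_solution A C G eps x -> bounded_trajectories x.
Proof.
move=> eps eps0 epsle.
have CS i j : (C i j)^T *m C i j = (C j i)^T *m C j i.
  exact: gram_castmx (C_sym i j).
suff main x : is_solution A C G eps x ->
    (forall i j, ((fun k => euclidean_norm (x k i - x k j)) @ \oo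
       --> (0 : R))%classic) /\ bounded_trajectories x.
  by split=> [x sol|x /main[]//]; have [] := main x sol.
move=> sol; have [n1_0|n1_gt0] := posnP n1.
  have Ast : stable A by apply: stable_neutral; rewrite // -n1E.
  apply: (tracking (c := fun=> 0)) => [i l|l]; last first.
    by under eq_fun do rewrite mxE; apply: bounded_seq_cst.
  under eq_fun do rewrite subr0.
  apply: (stable_cvg0 (w := fun k => x k i) _ Ast) => k.
  rewrite sol big1 ?scaler0 ?addr0 // => j _.
  by rewrite gains0 // !mul0mx.
have [] := gains_gt0 n1_gt0; have := epsbar_laplacian n1_gt0.
case: n / n12 A C G U W x sol C_diag C_sym C_connected A_neutral CA_detectable
  n1E gains0 gains_gt0 epsbar_laplacian CS => A C G U W x sol C_diag _
  C_connected _ CA_detectable _ _ _ _ CS psdL.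
rewrite !castmx_id => UWu AUW QQ Fst GE.
set V := invmx _ in AUW; have := block_similarity UWu AUW.
move: (usubmx V) (dsubmx V) => Y Z split_A.
have KE i j : G i j *m C i j = U *m Q *m U^T *m (C i j)^T *m C i j.
  by rewrite GE.
have Tst := disagreement_stable split_A C_diag CS C_connected CA_detectable
  QQ Fst KE psdL eps0 epsle.
have GCS i j : G i j *m C i j = G j i *m C j i.
  by rewrite !KE -!(mulmxA _ _ (C _ _)) CS.
apply: (tracking (c := fun k => mean (x k))).
  by move=> i l; apply: deviation_cvg0 Tst sol i l.
have [YA ZA] := left_modes split_A.
have [_ _ UYWZ _] := split_A.
have meanS := mean_solution GCS sol.
have -> : (fun k => mean (x k)) =
    (fun k => U *m (Y *m mean (x k)) + W *m (Z *m mean (x k))).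
  by apply/funext => k; rewrite !mulmxA -mulmxDl UYWZ mul1mx.
apply: bounded_vecD; apply: bounded_vec_mulmx.
  by apply: (orthogonal_bounded QQ) => k; rewrite meanS !mulmxA YA.
move=> l; apply: (@cvg_bounded_seq _ _ 0).
apply: (stable_cvg0 (w := fun k => Z *m mean (x k)) _ Fst) => k.
by rewrite meanS !mulmxA ZA.
Qed.
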